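(* Let $f(x)=\mathbb{E}_{v\sim D}[f_v(x)]$ on $\mathbb{R}^d$ be $L$-smooth with $L>0$, with at least one global minimizer $x_*$ and minimum value $f_*=f(x_* )$. Suppose there are constants $A,B,C$ with $B>0$ such that for all $x\in\mathbb{R}^d$ $$\mathbb{E}_v\big[\|\nabla f_v(x)\|^2\big]\le A\,(f(x)-f_* )+B\,\|\nabla f(x)\|^2+C .$$ Let $(x_k)_{k\ge 0}$ be the iterates of stochastic gradient descent with stochastic learning rate, $$x_{k+1}=x_k-\eta_k u_k\nabla f_{v_k}(x_k),\qquad k\in\mathbb{N}=\{0,1,2,\dots\},$$ where $x_0\in\mathbb{R}^d$, $(\eta_k)_k$ is a deterministic step size sequence and $(u_k)_k$ are the random stochasticity factors. Assume: (i) $0<u_k\le c_2$ for all $k$, where $c_2:=\sup_k u_k<\infty$ is a deterministic constant; (ii) $0<\mu_1\le\mathbb{E}_u[u_k]$ for all $k$, where $\mu_1:=\inf_k\mathbb{E}_u[u_k]$; (iii) the sequence $(\mathbb{E}_u[u_k])_k$ is monotone; (iv) $(\eta_k)_k$ is decreasing, $\sum_k\eta_k=\infty$, $\sum_k\eta_k^2<\infty$, and $\sum_{k\ge 1}\frac{\eta_k}{\sum_{j=0}^{k-1}\eta_j}=\infty$. Then the following hold (asymptotics as $k\to\infty$). (1.1a) If $\mathbb{E}_u[u_k]$ is decreasing in $k$, $\mathrm{Var}_u[u_k]$ is increasing in $k$, $\mathbb{E}_u[u_k]>\mathrm{Var}_u[u_k]+1$ for all $k$, and $0\le\eta_k\le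 \frac{1}{BL\,\mathbb{E}_u[u_k]}$ for all $k\in\mathbb{N}$, then $$\min_{t=0,\dots,k-1}\|\nabla f(x_t)\|^2=o\left(\frac{(\mathbb{E}_u[u_k]-\mathrm{Var}_u[u_k])^{-1}}{\sum_{t=0}^{k-1}\eta_t}\right)\quad\text{almost surely.}$$ (1.1b) If $\mathbb{E}_u[u_k]$ is decreasing in $k$ and $0\le\eta_k\le\frac{1}{BLc_2}$ for all $k\in\mathbb{N}$, then $$\min_{t=0,\dots,k-1}\|\nabla f(x_t)\|^2=o\left(\frac{1}{\mathbb{E}_u[u_k]\sum_{t=0}^{k-1}\eta_t}\right)\quad\text{almost surely.}$$ (1.2) If $\mathbb{E}_u[u_k]$ is increasing in $k$, $\mathrm{Var}_u[u_k]$ is decreasing in $k$, $\mathbb{E}_u[u_k]<1$ and $\frac{\mathrm{Var}_u[u_k]}{\mathbb{E}_u[u_k]}<1$ for all $k$, and $0\le\eta_k\le\frac{1}{BL}$ for all $k\in\mathbb{N}$, then $$\min_{t=0,\dots,k-1}\|\nabla f(x_t)\|^2=o\left(\frac{\mathbb{E}_u[u_k]-\mathrm{Var}_u[u_k]}{\sum_{t=0}^{k-1}\eta_t}\right)\quad\text{almost surely.}$$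
   Context: Setting: $v$ is a random variable with distribution $D$; for each value of $v$, $f_v:\mathbb{R}^d\to\mathbb{R}$ is differentiable, and $f(x):=\mathbb{E}_{v\sim D}[f_v(x)]$. The function $f$ need not be convex. ''$L$-smooth'' means $f$ is differentiable with $L$-Lipschitz gradient (Euclidean norm). The stochastic gradients are unbiased: $\mathbb{E}_{v\sim D}[\nabla f_v(x)]=\nabla f(x)$ for all $x$. Randomness: at each iteration $k$, the sample $v_k\sim D$ and the stochasticity factor $u_k$ (a real random variable whose distribution may depend on $k$) are drawn independently of each other and of all the previous draws $(v_j,u_j)_{j<k}$. $\mathbb{E}_u[u_k]$ and $\mathrm{Var}_u[u_k]$ denote the mean and variance of $u_k$; $\mathbb{E}_v$ denotes expectation over $v\sim D$. The bound $0<u_k\le c_2$ is understood almost surely, with $c_2$ the supremum over $k$ and over realizations. ''Increasing'', ''decreasing'' and ''monotone'' are meant in the weak (non-strict) sense. For random $a_k\ge 0$ and deterministic $b_k>0$, ''$a_k=o(b_k)$ almost surely'' means that $a_k/b_k\to 0$ as $k\to\infty$ with probability one. *)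

(* Defs.v *)
From HB Require Import structures.
From mathcomp Require Import all_boot all_order all_algebra.
From mathcomp Require Import all_classical all_reals all_analysis.

Set Implicit Arguments.
Unset Strict Implicit.
Unset Printing Implicit Defensive.

Import Order.TTheory GRing.Theory Num.Theory.
Import numFieldNormedType.Exports.

Local Open Scope classical_set_scope.
Local Open Scope ring_scope.

(* The canonical norm `|x| on 'rV[R]_d is the sup norm; the topology, hence
   differentiability, is the same for both norms. *)
Definition enorm (R : realType) (d : nat) (x : 'rV[R]_d) : R :=
  Num.sqrt (\sum_(i < d) x 0 i ^+ 2).

Definition grad (R : realType) (d : nat) (f : 'rV[R]_d -> R) (x : 'rV[R]_d) :
    'rV[R]_d :=
  \row_(i < d) 'D_(delta_mx 0 i) f x.

Definition smooth (R : realType) (d : nat) (L : R) (f : 'rV[R]_d -> R) : Prop :=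
  (forall x, differentiable f x) /\
  (forall x y, enorm (grad f x - grad f y) <= L * enorm (x - y)).

Section Random.
Context (R : realType) (dO : measure_display) (Omega : measurableType dO)
  (P : probability Omega R).

Definition mean (X : Omega -> R) : R := fine 'E_P[X].

Definition var (X : Omega -> R) : R := fine 'V_P[X].

(* Meant for sigma-algebras: since each of them contains setT, the product
   rule for triples includes the one for pairs. *)
Definition independent3 (G1 G2 G3 : set (set Omega)) : Prop :=
  forall A1 A2 A3, G1 A1 -> G2 A2 -> G3 A3 ->
    P (A1 `&` A2 `&` A3) = (P A1 * P A2 * P A3)%E.

Context (dV : measure_display) (V : measurableType dV).

Definition sigma_of (dT : measure_display) (T : measurableType dT)
    (X : Omega -> T) : set (set Omega) :=
  preimage_set_system setT X measurable.

Definition past (v : nat -> Omega -> V) (u : nat -> Omega -> R) (k : nat) :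
    set (set Omega) :=
  <<s \bigcup_(j in `I_k) (sigma_of (v j) `|` sigma_of (u j)) >>.

Definition independent_draws (v : nat -> Omega -> V) (u : nat -> Omega -> R) :
    Prop :=
  forall k, independent3 (sigma_of (v k)) (sigma_of (u k)) (past v u k).

(* Only eventual positivity of b matters; b 0 may be a division by zero. *)
Definition as_littleo (a : nat -> Omega -> R) (b : nat -> R) : Prop :=
  \forall w \ae P, (a k w / b k) @[k --> \oo] --> (0 : R).

End Random.

(* The minimum of g 0, ..., g (k - 1) for k > 0; the value at k = 0 is a
   placeholder. *)
Definition min_before (R : realType) (g : nat -> R) (k : nat) : R :=
  \big[Num.min/g 0%N]_(t < k) g t.

(* Main.v *)
Require Import Defs.
From HB Require Import structures.
From mathcomp Require Import all_boot all_order all_algebra.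
From mathcomp Require Import all_classical all_reals all_analysis.
From mathcomp Require Import ess_sup_inf measurable_realfun.
From mathcomp Require Import ring lra.

Import Order.TTheory GRing.Theory Num.Theory.
Import numFieldNormedType.Exports.

Local Open Scope classical_set_scope.
Local Open Scope ring_scope.

(** The descent lemma for the L-smooth function f gives, for fixed y = x_k and
    after averaging over the independent draws v_k and u_k,
      E[f(x_{k+1}) - f_*] <= (1 + a eta_k^2) E[f(x_k) - f_*]
                             - c eta_k E|grad f(x_k)|^2 + b eta_k^2,
    where c > 0 is obtained from the step size bound of each of the three cases.
    Taking full expectations, rather than conditional ones as in the
    Robbins-Siegmund theorem, already suffices: since sum eta_k^2 < oo,
    the recursion bounds sum eta_k E|grad f(x_k)|^2, so
    sum eta_k |grad f(x_k)|^2 < oo almost surely by Tonelli.  The running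
    minimum m_k of |grad f(x_t)|^2, t < k, then satisfies
    m_k (S_k - S_N) <= sum_(t >= N) eta_t |grad f(x_t)|^2 with S_k the partial
    sums of eta, hence m_k S_k -> 0 because S_k -> oo.  The prefactors of the
    three rates are bounded, so they do not matter. *)

Set Implicit Arguments.
Unset Strict Implicit.

(** * Independence and iterated integrals *)

Section independence.
Local Open Scope ereal_scope.
Context (R : realType) (dO : measure_display) (Omega : measurableType dO)
  (P : probability Omega R).

(** A law on the product is determined by its values on rectangles, so the pair has the product of
    the two laws as its law, and Tonelli iterates the integral. *)
Lemma ge0_integral_indep2 (d1 d2 : measure_display) (T1 : measurableType d1)
    (T2 : measurableType d2) (X : {mfun Omega >-> T1}) (Y : {mfun Omega >-> T2})
    (h : T1 * T2 -> \bar R) :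
  (forall A B, measurable A -> measurable B ->
    P (X @^-1` A `&` Y @^-1` B) = P (X @^-1` A) * P (Y @^-1` B)) ->
  measurable_fun [set: T1 * T2] h -> (forall z, 0 <= h z) ->
  \int[P]_w h (X w, Y w) =
  \int[distribution P Y]_y \int[distribution P X]_x h (x, y).
Proof.
move=> XY mh h0.
have mXY : measurable_fun setT (fun w => (X w, Y w)).
  by apply: measurable_fun_pair.
pose XYm : {mfun Omega >-> (T1 * T2)%type} :=
  HB.pack (fun w => (X w, Y w)) (isMeasurableFun.Build _ _ _ _ _ mXY).
rewrite -[LHS](ge0_integral_distribution XYm)//.
pose m1 : probability T1 R := distribution P X.
pose m2 : probability T2 R := distribution P Y.
transitivity (\int[m1 \x m2]_z h z).
  apply: eq_measure_integral => S mS _; apply/esym.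
  exact: product_measure_unique.
by rewrite (fubini_tonelli2 (m1 := m1) (m2 := m2)).
Qed.

(* Both sides are finite measures in S that agree on rectangles. *)
Lemma indep3_pair (d1 d2 : measure_display) (T1 : measurableType d1)
    (T2 : measurableType d2) (X : {mfun Omega >-> T1}) (Y : {mfun Omega >-> T2})
    (C : set Omega) :
  measurable C ->
  (forall A B, measurable A -> measurable B ->
    P (X @^-1` A `&` Y @^-1` B `&` C) = P (X @^-1` A `&` Y @^-1` B) * P C) ->
  forall S, measurable S -> P ((fun w => (X w, Y w)) @^-1` S `&` C) =
    P ((fun w => (X w, Y w)) @^-1` S) * P C.
Proof.
move=> mC XYC S mS.
have mXY : measurable_fun setT (fun w => (X w, Y w)).
  by apply: measurable_fun_pair.
pose XYm : {mfun Omega >-> (T1 * T2)%type} :=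
  HB.pack (fun w => (X w, Y w)) (isMeasurableFun.Build _ _ _ _ _ mXY).
have PC : P C \is a fin_num by rewrite fin_num_measure.
have PC0 : (0 <= fine (P C))%R by rewrite fine_ge0.
pose mu : {measure set (T1 * T2) -> \bar R} := pushforward (mrestr P mC) XYm.
pose m1 := mu mXY.
pose m2 : {measure set (T1 * T2) -> \bar R} :=
  mscale (NngNum PC0) (distribution P XYm).
pose G := [set A `*` B | A in (measurable : set (set T1))
                       & B in (measurable : set (set T2))].
suff : m1 S = m2 S.
  by rewrite /m1 /m2 /= /mscale /= fineK// muleC.
apply: (measure_unique G (fun=> setT)) => //.
- exact: measurable_prod_measurableType.
- move=> _ _ [A1 mA1 [B1 mB1 <-]] [A2 mA2 [B2 mB2 <-]].
  exists (A1 `&` A2); first exact: measurableI.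
  by exists (B1 `&` B2); [exact: measurableI|rewrite setXI].
- by move=> _; exists setT => //; exists setT => //; rewrite setXTT.
- by apply/seteqP; split => // x _; exists 0%N.
- move=> _ [A mA [B mB <-]].
  by rewrite /m1 /m2 /= /mscale /= fineK// muleC -XYC.
- move=> _; rewrite /m1 /= /pushforward /mrestr /= preimage_setT setTI.
  by rewrite ltey_eq PC.
Qed.

(** The two-variable lemma is used twice: for the pair [(X, Y)] against [Z], then for [X] against
    [Y] at a fixed value of [Z]. The outer integral stays over [Omega], so the identity acts as
    conditioning on [Z]. *)
Lemma ge0_integral_indep3 (d1 d2 d3 : measure_display) (T1 : measurableType d1)
    (T2 : measurableType d2) (T3 : measurableType d3)
    (X : {mfun Omega >-> T1}) (Y : {mfun Omega >-> T2})
    (Z : {mfun Omega >-> T3}) (h : T1 * T2 * T3 -> \bar R) :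
  (forall A B C, measurable A -> measurable B -> measurable C ->
    P (X @^-1` A `&` Y @^-1` B `&` Z @^-1` C) =
    P (X @^-1` A) * P (Y @^-1` B) * P (Z @^-1` C)) ->
  measurable_fun [set: T1 * T2 * T3] h -> (forall z, 0 <= h z) ->
  \int[P]_w h (X w, Y w, Z w) =
  \int[P]_w \int[distribution P Y]_y \int[distribution P X]_x h (x, y, Z w).
Proof.
move=> XYZ mh h0.
have mXY : measurable_fun setT (fun w => (X w, Y w)).
  by apply: measurable_fun_pair.
pose XYm : {mfun Omega >-> (T1 * T2)%type} :=
  HB.pack (fun w => (X w, Y w)) (isMeasurableFun.Build _ _ _ _ _ mXY).
have XY A B : measurable A -> measurable B ->
    P (X @^-1` A `&` Y @^-1` B) = P (X @^-1` A) * P (Y @^-1` B).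
  move=> mA mB; have := XYZ A B setT mA mB measurableT.
  by rewrite preimage_setT setIT probability_setT mule1.
rewrite (ge0_integral_indep2 (X := XYm) (Y := Z) (h := h)) //; last first.
  move=> S C mS mC; apply: indep3_pair => //.
    by rewrite -[X in measurable X]setTI; exact: measurable_funP.
  by move=> A B mA mB; rewrite XYZ// XY.
rewrite ge0_integral_distribution//; last 2 first.
- exact: measurable_fun_fubini_tonelli_G.
- by move=> y; exact: integral_ge0.
apply: eq_integral => w _ /=.
have mhZ : measurable_fun setT (fun z => h (z, Z w)).
  apply: measurableT_comp => //; exact: measurable_fun_pair.
rewrite (ge0_integral_distribution XYm)//.
exact: (ge0_integral_indep2 (X := X) (Y := Y) (h := fun z => h (z, Z w))).
Qed.

End independence.

(** * The descent lemma *)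

Section smooth.
Context (R : realType) (d : nat).
Implicit Types (x y z : 'rV[R]_d) (f : 'rV[R]_d -> R).

Lemma enorm_sqr x : enorm x ^+ 2 = \sum_(i < d) x 0 i ^+ 2.
Proof. by rewrite sqr_sqrtr// sumr_ge0// => i _; rewrite sqr_ge0. Qed.

Lemma enorm_ge0 x : 0 <= enorm x.
Proof. exact: sqrtr_ge0. Qed.

Lemma enorm_sqrZ (t : R) x : enorm (t *: x) ^+ 2 = t ^+ 2 * enorm x ^+ 2.
Proof.
by rewrite !enorm_sqr mulr_sumr; apply: eq_bigr => i _; rewrite mxE exprMn.
Qed.

Lemma derive_grad f x z : differentiable f x ->
  'D_z f x = \sum_(i < d) z 0 i * grad f x 0 i.
Proof.
move=> df; rewrite deriveE// {1}(row_sum_delta z) linear_sum.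
by apply: eq_bigr => i _; rewrite linearZ mxE deriveE.
Qed.

Lemma is_derive_line f y z (t : R) : differentiable f (y + t *: z) ->
  is_derive t (1 : R) (fun s => f (y + s *: z)) ('D_z f (y + t *: z)).
Proof.
move=> df; have dz : derivable f (y + t *: z) z by exact: diff_derivable.
have E' : (fun h : R => h^-1 *: (((fun s => f (y + s *: z)) \o shift t)
     (h *: (1 : R)) - f (y + t *: z))) =
   (fun h : R => h^-1 *: ((f \o shift (y + t *: z)) (h *: z)
     - f (y + t *: z))).
  by apply/funext => h /=; congr (_ *: (f _ - _));
    rewrite scalerDl addrCA scaler1.
by split; rewrite /derivable /derive E'.
Qed.

Lemma smooth_descent (L : R) f y z : 0 < L -> smooth L f ->
  f (y + z) <= f y + \sum_(i < d) z 0 i * grad f y 0 i + L / 2 * enorm z ^+ 2.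
Proof.
move=> L0 [df lip].
set s := \sum_(i < d) _; set e := enorm z ^+ 2.
(* [phi] is [f] along the segment minus the quadratic upper bound without its constant term. The
   claim is [phi 1 <= phi 0], which the mean value theorem reduces to [dphi c <= 0]. *)
pose phi (t : R) := f (y + t *: z) - (t * s + L / 2 * e * t ^+ 2).
pose dphi (t : R) := 'D_z f (y + t *: z) - (s + L * e * t).
have phi' t : is_derive t (1 : R) phi (dphi t).
  have H1 := is_derive_line (df (y + t *: z)).
  apply: is_deriveB; apply: is_derive_eq.
  by rewrite /GRing.scale /= !mulr1 mulr0 add0r; field.
have [|c /[!in_itv]/= /andP[c0 c1]] := MVT (ltr01 : (0 : R) < 1) (fun t _ => phi' t).
  by apply: derivable_within_continuous => t _; have [] := phi' t.
rewrite subr0 mulr1 /phi scale1r scale0r addr0.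
suff : dphi c <= 0 by lra.
rewrite /dphi derive_grad// subr_le0 -lerBlDl -sumrB.
(* AM-GM in each coordinate takes the place of Cauchy-Schwarz. *)
have le1 i : z 0 i * grad f (y + c *: z) 0 i - z 0 i * grad f y 0 i <=
    L * c / 2 * z 0 i ^+ 2 +
    (2 * L * c)^-1 * ((grad f (y + c *: z) - grad f y) 0 i) ^+ 2.
  rewrite -mulrBr !mxE; set a := _ - _; set b := z 0 i.
  have Lc : 0 < L * c by rewrite mulr_gt0.
  rewrite -subr_ge0 (_ : _ - _ = (2 * L * c)^-1 * (L * c * b - a) ^+ 2).
    by rewrite mulr_ge0 ?sqr_ge0// invr_ge0 -mulrA mulr_ge0// ltW.
  by field; rewrite !gt_eqF.
apply: (le_trans (ler_sum _ (fun i _ => le1 i))).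
rewrite big_split /= -!mulr_sumr -!enorm_sqr -/e.
(* The Lipschitz bound over the displacement [c *: z] brings the second AM-GM term down to
   [L * c / 2 * e], the size of the first; together they give exactly the [L * e * c] available in
   [dphi c]. *)
have : enorm (grad f (y + c *: z) - grad f y) ^+ 2 <= (L * c) ^+ 2 * e.
  rewrite exprMn -mulrA -enorm_sqrZ -exprMn lerXn2r// ?nnegrE ?enorm_ge0//.
    by rewrite mulr_ge0 ?enorm_ge0// ltW.
  by apply: le_trans (lip _ _) _; rewrite [y + _]addrC addrK.
have i0 : 0 <= (2 * L * c)^-1 by rewrite invr_ge0 !mulr_ge0// ltW.
move=> /(ler_wpM2l i0) H; apply: le_trans (lerD (lexx _) H) _.
by rewrite le_eqVlt; apply/orP; left; apply/eqP; field; rewrite !gt_eqF.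
Qed.

End smooth.

(** * Measurability of the stochastic gradients *)

Section caratheodory.
Context (R : realType) (d : nat) (dT : measure_display) (T : measurableType dT).

(** A preimage splits into countably many pieces, one for each value of [g], and on each piece the
    second argument is constant. *)
Lemma measurable_fun_countable_arg (K : countType) (g : T -> K)
    (F : T -> K -> R) :
  (forall k, measurable (g @^-1` [set k])) ->
  (forall k, measurable_fun [set: T] (F ^~ k)) ->
  measurable_fun [set: T] (fun t => F t (g t)).
Proof.
move=> mg mF _ B mB.
rewrite setTI (_ : _ @^-1` B =
    \bigcup_k (g @^-1` [set k] `&` (F ^~ k) @^-1` B)); last first.
  by apply/seteqP; split=> [t Bt|t [k _ [/= <-]]//]; exists (g t).
apply: countable_bigcupT_measurable => // k; apply: measurableI => //.
by rewrite -[X in measurable X]setTI; exact: mF.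
Qed.

(** Continuity in the second argument makes the value at [Y] a pointwise limit of values at
    countably valued approximations of [Y], to which the previous lemma applies. *)
Lemma measurable_fun_caratheodory (F : T -> 'rV[R]_d -> R) (Y : T -> 'rV[R]_d) :
  (forall y, measurable_fun [set: T] (F ^~ y)) ->
  (forall t, continuous (F t)) ->
  (forall i, measurable_fun [set: T] (fun t => Y t 0 i)) ->
  measurable_fun [set: T] (fun t => F t (Y t)).
Proof.
move=> mF cF mY.
(* Rounding Y down to the lattice of mesh 1/(n+1) makes it countably valued. *)
pose rnd n (y : 'rV[R]_d) : 'rV[int]_d :=
  \row_i Num.floor (y 0 i * n.+1%:R).
pose unrnd n (z : 'rV[int]_d) : 'rV[R]_d := \row_i ((z 0 i)%:~R / n.+1%:R).
apply: (measurable_fun_cvg (h := fun n t => F t (unrnd n (rnd n (Y t))))) => [n|t _].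
  apply: (measurable_fun_countable_arg (g := fun t => rnd n (Y t))
    (F := fun t z => F t (unrnd n z))) => // z.
  rewrite (_ : _ @^-1` _ = \bigcap_(i in [set: 'I_d])
    ((fun t => Y t 0 i * n.+1%:R) @^-1` `[(z 0 i)%:~R, (z 0 i + 1)%:~R[)).
    apply: fin_bigcap_measurable => // i _.
    rewrite -[X in measurable X]setTI.
    have : measurable_fun [set: T] (fun t => Y t 0 i * n.+1%:R).
      exact: measurable_funM.
    by apply => //; exact: measurable_itv.
  apply/seteqP; split=> [t /= <- i _ /=|t /= H].
    by rewrite mxE in_itv /= floor_itv.
  apply/rowP => i; rewrite mxE; have := H i I; rewrite /= in_itv /= => zi.
  exact: floor_def.
suff : unrnd n (rnd n (Y t)) @[n --> \oo] --> Y t.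
  by move=> /cvg_comp; apply; exact: cF.
apply/cvg_ballP => e e0; near=> n; split => // i j.
rewrite !mxE ord1 /ball /=.
have := floor_itv (Y t 0 j * n.+1%:R); set z := Num.floor _ => /andP[z1 z2].
have n0 : 0 < n.+1%:R :> R by [].
have : n.+1%:R^-1 < e by near: n; exact: (near_infty_natSinv_lt (PosNum e0)).
apply: le_lt_trans.
rewrite ger0_norm ?subr_ge0 ?ler_pdivrMr//.
move: z2; rewrite intrD1 -ltr_pdivlMr// mulrDl mul1r => /ltW.
by rewrite lerBlDl addrC.
Unshelve. all: by end_near. Qed.

(** The increments 1/(n+1) exhibit a directional derivative as the limit of a sequence, the form in
    which measurability passes to the limit. *)
Lemma cvg_derive_natSinv (f : 'rV[R]_d -> R) y v : differentiable f y ->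
  (n.+1%:R * (f (n.+1%:R^-1 *: v + y) - f y)) @[n --> \oo] --> 'D_v f y.
Proof.
move=> df; have fv : derivable f y v by exact: diff_derivable.
have : (h^-1 * (f (h *: v + y) - f y)) @[h --> 0^'] --> 'D_v f y by exact: fv.
move=> /cvgr_dnbhsP/(_ (fun n => n.+1%:R^-1)).
under [X in _ -> X @ _ --> _]eq_fun do rewrite invrK.
by apply; split => [n|]; [rewrite invr_eq0 pnatr_eq0|exact: cvg_harmonic].
Qed.

Lemma measurable_fun_grad (F : T -> 'rV[R]_d -> R) (Y : T -> 'rV[R]_d) i :
  (forall y, measurable_fun [set: T] (F ^~ y)) ->
  (forall t y, differentiable (F t) y) ->
  (forall i, measurable_fun [set: T] (fun t => Y t 0 i)) ->
  measurable_fun [set: T] (fun t => grad (F t) (Y t) 0 i).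
Proof.
move=> mF dF mY.
have cF t : continuous (F t) by move=> y; exact: differentiable_continuous.
apply: (measurable_fun_cvg (h := fun n t => n.+1%:R *
  (F t (n.+1%:R^-1 *: delta_mx 0 i + Y t) - F t (Y t)))) => [n|t _].
  apply: measurable_funM => //; apply: measurable_funB.
    apply: (measurable_fun_caratheodory (F := F)
      (Y := fun t => n.+1%:R^-1 *: delta_mx 0 i + Y t)) => // j.
    by under eq_fun do rewrite mxE; exact: measurable_funD.
  exact: measurable_fun_caratheodory.
by rewrite mxE; exact: cvg_derive_natSinv.
Qed.

End caratheodory.

(** * The expected decrease in one step *)

Section has_mean.
Context (R : realType) (dT : measure_display) (T : measurableType dT)
  (mu : probability T R).
Implicit Types (X Y : T -> R) (m c : R).

(** Integrability is bundled with a real value of the integral, so that linearity can be computed in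
    [R] without side conditions on infinite values. *)
Definition has_mean X m :=
  mu.-integrable [set: T] (EFin \o X) /\ (\int[mu]_x (X x)%:E = m%:E)%E.

Lemma has_mean_cst c : has_mean (fun=> c) c.
Proof.
split; first exact: finite_measure_integrable_cst.
by have := expectation_cst mu c; rewrite unlock.
Qed.

Lemma has_meanD X Y m m' : has_mean X m -> has_mean Y m' ->
  has_mean (fun x => X x + Y x) (m + m').
Proof.
move=> [iX EX] [iY EY]; split; first exact: (integrableD measurableT iX iY).
rewrite (_ : (fun x => (X x + Y x)%:E) = (fun x => (X x)%:E + (Y x)%:E)%E)//.
by rewrite integralD// EX EY.
Qed.

Lemma has_meanZ c X m : has_mean X m -> has_mean (fun x => c * X x) (c * m).
Proof.
move=> [iX EX]; split; first exact: (integrableZl _ c iX).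
rewrite (_ : (fun x => (c * X x)%:E) = (fun x => c%:E * (X x)%:E)%E)//.
by rewrite integralZl// EX.
Qed.

Lemma has_mean_sum (I : Type) (s : seq I) (X : I -> T -> R) (m : I -> R) :
  (forall i, has_mean (X i) (m i)) ->
  has_mean (fun x => \sum_(i <- s) X i x) (\sum_(i <- s) m i).
Proof.
move=> H; elim: s => [|i s IH].
  by under eq_fun do rewrite big_nil; rewrite big_nil; exact: has_mean_cst.
by under eq_fun do rewrite big_cons; rewrite big_cons; exact: has_meanD.
Qed.

Lemma has_mean_integrable X : mu.-integrable [set: T] (EFin \o X) ->
  has_mean X (fine (\int[mu]_x (X x)%:E)).
Proof. by move=> iX; split => //; rewrite fineK// integrable_fin_num. Qed.

Lemma has_mean_ae_ge0 X m : {ae mu, forall x, 0 <= X x} -> has_mean X m ->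
  0 <= m.
Proof.
move=> X0 [iX EX]; rewrite -lee_fin -EX.
rewrite (ae_eq_integral (fun x => `|(X x)%:E|)%E) ?integral_ge0//.
- exact: measurable_int iX.
- by apply: measurableT_comp => //; exact: measurable_int iX.
by apply: filterS X0 => x X0 _; rewrite gee0_abs.
Qed.

Lemma has_mean_ae_bounded X c : measurable_fun [set: T] X ->
  {ae mu, forall x, `|X x| <= c} ->
  has_mean X (fine (\int[mu]_x (X x)%:E)).
Proof.
move=> mX Xc; apply: has_mean_integrable; apply/integrableP.
split; first exact/measurable_EFinP.
(* The maximum with 0 keeps the dominating constant nonnegative whatever the sign of [c]. *)
have : (\int[mu]_x `|(EFin \o X) x| <= \int[mu]_x (Num.max c 0)%:E)%E.
  apply: ae_ge0_le_integral => //.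
  - by apply: measurableT_comp => //; exact/measurable_EFinP.
  - by move=> x _; rewrite lee_fin le_max lexx orbT.
  - by apply: filterS Xc => x Xc _; rewrite lee_fin le_max Xc.
by move=> /le_lt_trans; apply; rewrite (has_mean_cst _).2 ltry.
Qed.

End has_mean.

Section one_step.
Context (R : realType) (d : nat).

(** The descent lemma is averaged over one sample at a fixed point and a fixed step [a]:
    unbiasedness turns the linear term into the squared gradient norm, and [K] bounds the quadratic
    term. *)
Lemma expected_descent (dV : measure_display) (V : measurableType dV)
    (D : probability V R) (L : R) (f : 'rV[R]_d -> R) (fs : R)
    (g : V -> 'rV[R]_d) (y : 'rV[R]_d) (K a : R) :
  0 < L -> smooth L f -> (forall x, fs <= f x) ->
  (forall i, measurable_fun [set: V] (fun s => g s 0 i)) ->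
  (forall i, (\int[D]_s (g s 0 i)%:E)%E = (grad f y 0 i)%:E) ->
  (\int[D]_s (enorm (g s) ^+ 2)%:E <= K%:E)%E ->
  (\int[D]_s (f (y - a *: g s) - fs)%:E <=
    (f y - fs - a * enorm (grad f y) ^+ 2 + L / 2 * a ^+ 2 * K)%:E)%E.
Proof.
move=> L0 sf fmin mg Eg gK.
have mg2 : measurable_fun [set: V] (fun s => enorm (g s) ^+ 2).
  under eq_fun do rewrite enorm_sqr.
  by apply: measurable_sum => i; exact: measurable_funX.
have ig2 : D.-integrable [set: V] (EFin \o (fun s => enorm (g s) ^+ 2)).
  apply/integrableP; split; first exact/measurable_EFinP.
  under eq_integral do rewrite /= ger0_norm ?sqr_ge0//.
  by rewrite (le_lt_trans gK)// ltry.
(* The second moment dominates each coordinate through t <= 1 + t^2, which follows from (t - 1)^2 >=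
   0 for t >= 0. *)
have ig i : D.-integrable [set: V] (EFin \o (fun s => g s 0 i)).
  apply: (@le_integrable _ _ _ D _ measurableT _
      (EFin \o (fun s => 1 + enorm (g s) ^+ 2))) => //.
  - exact/measurable_EFinP.
  - move=> s _; rewrite /= lee_fin [leRHS]ger0_norm ?addr_ge0 ?sqr_ge0//.
    have : `|g s 0 i| ^+ 2 <= enorm (g s) ^+ 2.
      rewrite real_normK ?num_real// enorm_sqr (bigD1 i)//= lerDl.
      by apply: sumr_ge0 => j _; exact: sqr_ge0.
    by have := sqr_ge0 (`|g s 0 i| - 1); nra.
  - by apply: (has_meanD (has_mean_cst D 1) (has_mean_integrable ig2)).1.
have [_ Eg2] := has_mean_integrable ig2; set K' := fine _ in Eg2.
have hg i : has_mean D (fun s => g s 0 i) (grad f y 0 i) by split.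
pose up s := f y - fs + - a * (\sum_(i < d) grad f y 0 i * g s 0 i) +
  L / 2 * a ^+ 2 * enorm (g s) ^+ 2.
have hup : has_mean D up
    (f y - fs + - a * enorm (grad f y) ^+ 2 + L / 2 * a ^+ 2 * K').
  apply: has_meanD; last by apply: has_meanZ.
  apply: has_meanD; first exact: has_mean_cst.
  apply: has_meanZ; rewrite enorm_sqr.
  by apply: has_mean_sum => i; rewrite expr2; exact: has_meanZ.
have K'K : K' <= K by rewrite -lee_fin -Eg2.
apply: (@le_trans _ _ (f y - fs + - a * enorm (grad f y) ^+ 2
    + L / 2 * a ^+ 2 * K')%:E); last first.
  rewrite lee_fin mulNr lerD2l ler_wpM2l// mulr_ge0 ?sqr_ge0//.
  by rewrite divr_ge0// ltW.
have fup s : f (y - a *: g s) - fs <= up s.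
  rewrite /up.
  have := smooth_descent y (- (a *: g s)) L0 sf.
  rewrite -scaleNr enorm_sqrZ sqrrN mulr_sumr.
  have -> : \sum_(i < d) (- a *: g s) 0 i * grad f y 0 i =
      \sum_(i < d) - a * (grad f y 0 i * g s 0 i).
    by apply: eq_bigr => i _; rewrite mxE; ring.
  rewrite [L / 2 * (_ * _)]mulrA; lra.
rewrite -hup.2; apply: ge0_le_integral => //.
- by move=> s _; rewrite lee_fin subr_ge0.
- apply/measurable_EFinP; apply: measurable_funB => //.
  apply: (@measurable_fun_caratheodory _ _ _ _ (fun=> f)
    (fun s => y - a *: g s)) => [x|_ x|i].
  + by [].
  + by apply: differentiable_continuous; exact: sf.1.
  under eq_fun do rewrite !mxE.
  by apply: measurable_funB => //; exact: measurable_funM.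
- exact: measurable_int hup.1.
- by move=> s _; rewrite lee_fin.
Qed.

End one_step.

(** * Measurability of the iterates with respect to the past draws *)

Section past_measurability.
Context (R : realType) (dO : measure_display) (Omega : measurableType dO).

Lemma measurable_fun_sub_sigma (dU : measure_display) (U : measurableType dU)
    (G G' : set (set Omega)) (X : Omega -> U) : G `<=` G' ->
  measurable_fun (T := g_sigma_algebraType G) setT X ->
  measurable_fun (T := g_sigma_algebraType G') setT X.
Proof.
move=> GG' mX _ B mB; have := mX measurableT B mB.
exact: sub_sigma_algebra2.
Qed.

Lemma measurable_fun_g_sigma (dU : measure_display) (U : measurableType dU)
    (G : set (set Omega)) (X : Omega -> U) : sigma_of X `<=` G ->
  measurable_fun (T := g_sigma_algebraType G) setT X.
Proof.
by move=> XG _ B mB; apply: sub_sigma_algebra; apply: XG; exists B.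
Qed.

Context (P : probability Omega R) (dV : measure_display) (V : measurableType dV)
  (v : nat -> {RV P >-> V}) (u : nat -> {RV P >-> R}).

(* [past_type k] is Omega with the sigma-algebra [past v u k]. *)
Definition past_gen k : set (set Omega) :=
  \bigcup_(j in `I_k) (sigma_of (v j) `|` sigma_of (u j)).

Definition past_type k := g_sigma_algebraType (past_gen k).

Lemma sub_past_gen k : past_gen k `<=` past_gen k.+1.
Proof.
by move=> A [j /= jk jA]; exists j => //=; rewrite (ltn_trans jk).
Qed.

Lemma past_gen_measurable k : past_gen k `<=` measurable.
Proof.
move=> A [j _ [|] [B mB <-]]; exact: measurable_funP.
Qed.

(** The past is a sub-sigma-algebra of the ambient one. Hence the identity is a random variable with
    values in [past_type k], and the whole past can be the third variable of the independence
    lemma. *)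
Lemma measurable_past_id k :
  measurable_fun [set: Omega] (idfun : Omega -> past_type k).
Proof.
move=> _ B mB; rewrite setTI preimage_id; move: B mB.
apply: smallest_sub; last exact: past_gen_measurable.
exact: sigma_algebra_measurable.
Qed.

Context (d : nat) (fv : V -> 'rV[R]_d -> R) (eta : nat -> R) (x0 : 'rV[R]_d)
  (x : nat -> Omega -> 'rV[R]_d).
Context (fv_diff : forall s y, differentiable (fv s) y)
  (fv_meas : forall y, measurable_fun [set: V] (fv ^~ y))
  (x_init : forall w, x 0%N w = x0)
  (x_step : forall k w,
      x k.+1 w = x k w - (eta k * u k w) *: grad (fv (v k w)) (x k w)).

(** By induction along the update rule, only draws with index below [k] enter the iterate [x k]; the
    draws [v k] and [u k] first enter in [x k.+1]. *)
Lemma iterate_past_measurable k i :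
  measurable_fun (T := past_type k) setT (fun w => x k w 0 i).
Proof.
elim: k i => [|k IH] i.
  have -> : (fun w => x 0%N w 0 i) = (fun=> x0 0 i).
    by apply/funext => w; rewrite x_init.
  by [].
have mx j : measurable_fun (T := past_type k.+1) setT (fun w => x k w 0 j).
  by apply: measurable_fun_sub_sigma (IH j); exact: sub_past_gen.
have mv : measurable_fun (T := past_type k.+1) setT (v k).
  by apply: measurable_fun_g_sigma => A vA; exists k; [exact: ltnSn|left].
have mu : measurable_fun (T := past_type k.+1) setT (u k).
  by apply: measurable_fun_g_sigma => A uA; exists k; [exact: ltnSn|right].
have -> : (fun w => x k.+1 w 0 i) = (fun w => x k w 0 i -
    eta k * u k w * grad (fv (v k w)) (x k w) 0 i).
  by apply/funext => w; rewrite x_step mxE [X in _ + X]mxE [X in - X]mxE.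
apply: measurable_funB => //; apply: measurable_funM.
  by apply: measurable_funM.
apply: (@measurable_fun_grad R d _ (past_type k.+1) (fun w => fv (v k w)) (x k)).
- by move=> y; exact: (measurableT_comp (fv_meas y)).
- by [].
- by [].
Qed.

End past_measurability.

(** * One step of the stochastic iteration in full expectation *)

Section sgd_step.
Context (R : realType) (d : nat) (dV : measure_display) (V : measurableType dV)
  (D : probability V R) (fv : V -> 'rV[R]_d -> R) (f : 'rV[R]_d -> R)
  (L fs : R) (K : 'rV[R]_d -> R).
Context (fv_diff : forall s y, differentiable (fv s) y)
  (fv_meas : forall y, measurable_fun [set: V] (fv ^~ y))
  (unbiased : forall y i,
    (\int[D]_s (grad (fv s) y 0 i)%:E)%E = (grad f y 0 i)%:E)
  (L_gt0 : 0 < L) (f_smooth : smooth L f) (f_ge : forall y, fs <= f y)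
  (K_ge : forall y, (\int[D]_s (enorm (grad (fv s) y) ^+ 2)%:E <= (K y)%:E)%E).
Context (dO : measure_display) (Omega : measurableType dO)
  (P : probability Omega R).

Let f_continuous : continuous f.
Proof. by move=> y; apply: differentiable_continuous; exact: f_smooth.1. Qed.

(** The bound for a fixed step [e * t] is a quadratic polynomial in the value [t] of the factor, so
    integrating over [t] involves only the first two moments of [u]. *)
Lemma expected_sgd_step_at (u : {RV P >-> R}) (e m m2 : R) y :
  has_mean P u m -> has_mean P (fun w => u w ^+ 2) m2 ->
  (\int[distribution P u]_t \int[D]_s
     (f (y - (e * t) *: grad (fv s) y) - fs)%:E <=
   (f y - fs - e * m * enorm (grad f y) ^+ 2 +
     L / 2 * e ^+ 2 * m2 * K y)%:E)%E.
Proof.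
move=> hm hm2; pose h (z : V * R) : \bar R :=
  (f (y - (e * z.2) *: grad (fv z.1) y) - fs)%:E.
have mgrad i : measurable_fun [set: V] (fun s => grad (fv s) y 0 i).
  by apply: (@measurable_fun_grad _ _ _ _ fv (fun=> y)).
have h0 z : (0 <= h z)%E by rewrite lee_fin subr_ge0.
have mh : measurable_fun [set: V * R] h.
  apply/measurable_EFinP; apply: measurable_funB => //.
  apply: (@measurable_fun_caratheodory _ _ _ _ (fun=> f)
    (fun z : V * R => y - (e * z.2) *: grad (fv z.1) y)) => [t|_|i].
  - by [].
  - exact: f_continuous.
  have -> : (fun z : V * R => (y - (e * z.2) *: grad (fv z.1) y) 0 i) =
      (fun z => y 0 i - e * z.2 * grad (fv z.1) y 0 i).
    by apply/funext => z; rewrite mxE [X in _ + X]mxE [X in - X]mxE.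
  apply: measurable_funB => //; apply: measurable_funM.
    by apply: measurable_funM => //; exact: measurable_snd.
  exact: (measurableT_comp (mgrad i) measurable_fst).
pose r t := f y - fs - e * t * enorm (grad f y) ^+ 2 +
  L / 2 * (e * t) ^+ 2 * K y.
have hr t : (\int[D]_s h (s, t) <= (r t)%:E)%E.
  exact: expected_descent.
(* The signs of the terms of [r t] are not known; nonnegativity comes from dominating the integral
   of a nonnegative function. *)
have r0 t : (0 <= (r t)%:E)%E.
  by apply: le_trans (hr t); exact: integral_ge0.
have mr : measurable_fun [set: R] (fun t => (r t)%:E).
  apply/measurable_EFinP; apply: measurable_funD.
    by apply: measurable_funB => //; apply: measurable_funM.
  apply: measurable_funM => //; apply: measurable_funM => //.
  by apply: measurable_funX; exact: measurable_funM.
apply: (@le_trans _ _ (\int[distribution P u]_t (r t)%:E)%E).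
  apply: ge0_le_integral => //.
  - by move=> t _; apply: integral_ge0 => s _; exact: (h0 (s, t)).
  - exact: (measurable_fun_fubini_tonelli_G (m1 := D) h mh h0).
  - by move=> t _; exact: hr.
rewrite (ge0_integral_distribution u mr r0).
have hr2 : has_mean P (r \o u) (f y - fs + - (e * enorm (grad f y) ^+ 2) * m +
    L / 2 * e ^+ 2 * K y * m2).
  have -> : r \o u = (fun w => (f y - fs + - (e * enorm (grad f y) ^+ 2) * u w) +
      L / 2 * e ^+ 2 * K y * u w ^+ 2).
    by apply/funext => w; rewrite /r /=; ring.
  apply: has_meanD; last exact: has_meanZ.
  by apply: has_meanD; [exact: has_mean_cst|exact: has_meanZ].
by rewrite hr2.2 lee_fin le_eqVlt; apply/orP; left; apply/eqP; ring.
Qed.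

Context (v : nat -> {RV P >-> V}) (u : nat -> {RV P >-> R})
  (eta : nat -> R) (x0 : 'rV[R]_d) (x : nat -> Omega -> 'rV[R]_d).
Context
  (v_law : forall k (S : set V), measurable S -> distribution P (v k) S = D S)
  (uv_indep : independent_draws P v u)
  (x_init : forall w, x 0%N w = x0)
  (x_step : forall k w,
      x k.+1 w = x k w - (eta k * u k w) *: grad (fv (v k w)) (x k w)).

Lemma iterate_measurable k i : measurable_fun [set: Omega] (fun w => x k w 0 i).
Proof.
have := iterate_past_measurable fv_diff fv_meas x_init x_step (k := k) i.
by move=> /measurableT_comp/(_ (@measurable_past_id _ _ _ _ _ _ v u k)).
Qed.

(** The pointwise bound at a frozen iterate is integrated over the past. The gradient term stands on
    the left, so all integrals are of nonnegative functions and none has to be known finite. *)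
Lemma expected_sgd_step k (m m2 p q r : R) :
  has_mean P (u k) m -> has_mean P (fun w => u k w ^+ 2) m2 ->
  0 <= p -> 0 <= q -> 0 <= r ->
  (forall y, f y - fs - eta k * m * enorm (grad f y) ^+ 2 +
    L / 2 * eta k ^+ 2 * m2 * K y <=
    p * (f y - fs) - q * enorm (grad f y) ^+ 2 + r) ->
  (\int[P]_w (f (x k.+1 w) - fs)%:E +
     q%:E * \int[P]_w (enorm (grad f (x k w)) ^+ 2)%:E <=
   p%:E * \int[P]_w (f (x k w) - fs)%:E + r%:E)%E.
Proof.
move=> hm hm2 p0 q0 r0 bound.
(* The events of [Z] are those of the past, and [x k] is a measurable function of [Z]. *)
pose Z : {mfun Omega >-> past_type v u k} :=
  HB.pack (idfun : Omega -> past_type v u k)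
  (isMeasurableFun.Build _ _ _ _ _ (@measurable_past_id _ _ _ _ _ _ v u k)).
pose h (z : V * R * past_type v u k) : \bar R :=
  (f (x k z.2 - (eta k * z.1.2) *: grad (fv z.1.1) (x k z.2)) - fs)%:E.
have h0 z : (0 <= h z)%E by rewrite lee_fin subr_ge0.
have mxk i : measurable_fun [set: V * R * past_type v u k] (fun z => x k z.2 0 i).
  exact: (measurableT_comp (iterate_past_measurable fv_diff fv_meas x_init
    x_step (k := k) i) measurable_snd).
have mh : measurable_fun [set: V * R * past_type v u k] h.
  apply/measurable_EFinP; apply: measurable_funB => //.
  apply: (@measurable_fun_caratheodory _ _ _ _ (fun=> f)
    (fun z : V * R * past_type v u k =>
      x k z.2 - (eta k * z.1.2) *: grad (fv z.1.1) (x k z.2))) => [t|_|i].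
  - by [].
  - exact: f_continuous.
  have -> : (fun z : V * R * past_type v u k =>
      (x k z.2 - (eta k * z.1.2) *: grad (fv z.1.1) (x k z.2)) 0 i) =
      (fun z => x k z.2 0 i - eta k * z.1.2 * grad (fv z.1.1) (x k z.2) 0 i).
    by apply/funext => z; rewrite mxE [X in _ + X]mxE [X in - X]mxE.
  apply: measurable_funB => //; apply: measurable_funM.
    apply: measurable_funM => //.
    exact: (measurableT_comp measurable_snd measurable_fst).
  apply: (@measurable_fun_grad _ _ _ _ (fun z : V * R * past_type v u k => fv z.1.1)
    (fun z => x k z.2)) => // y.
  by apply: (measurableT_comp (fv_meas y));
    exact: (measurableT_comp measurable_fst measurable_fst).
have mD : measurable_fun [set: Omega] (fun w => f (x k w) - fs).
  apply: measurable_funB => //.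
  apply: (@measurable_fun_caratheodory _ _ _ _ (fun=> f) (x k)) => [t|_|i].
  - by [].
  - exact: f_continuous.
  - exact: iterate_measurable.
have mG : measurable_fun [set: Omega] (fun w => enorm (grad f (x k w)) ^+ 2).
  under eq_fun do rewrite enorm_sqr.
  apply: measurable_sum => i; apply: measurable_funX.
  apply: (@measurable_fun_grad _ _ _ _ (fun=> f) (x k)) => [y|_ y|j].
  - by [].
  - exact: f_smooth.1.
  - exact: iterate_measurable.
pose bnd w := p * (f (x k w) - fs) - q * enorm (grad f (x k w)) ^+ 2 + r.
have step w : (\int[distribution P (u k)]_t \int[distribution P (v k)]_s
    h (s, t, Z w) <= (bnd w)%:E)%E.
  apply: (@le_trans _ _ (\int[distribution P (u k)]_t \int[D]_s h (s, t, Z w))%E).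
    rewrite le_eqVlt; apply/orP; left; apply/eqP; apply: eq_integral => t _.
    by apply: eq_measure_integral => S mS _; exact: v_law.
  have H := expected_sgd_step_at (eta k) (x k w) hm hm2.
  apply: (le_trans H).
  by rewrite lee_fin; exact: bound.
have bnd0 w : 0 <= bnd w.
  rewrite -lee_fin; apply: le_trans (step w).
  by apply: integral_ge0 => t _; exact: integral_ge0.
have mbnd : measurable_fun [set: Omega] bnd.
  apply: measurable_funD => //; apply: measurable_funB; exact: measurable_funM.
have le1 : (\int[P]_w (f (x k.+1 w) - fs)%:E <= \int[P]_w (bnd w)%:E)%E.
  have -> : (\int[P]_w (f (x k.+1 w) - fs)%:E = \int[P]_w h (v k w, u k w, Z w))%E.
    by apply: eq_integral => w _; rewrite /h x_step.
  rewrite (ge0_integral_indep3 (X := v k) (Y := u k) (Z := Z))//; last first.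
    move=> A B C mA mB mC; apply: uv_indep.
    - by exists A => //; rewrite setTI.
    - by exists B => //; rewrite setTI.
    - exact: mC.
  apply: ge0_le_integral => //.
  - by move=> w _; apply: integral_ge0 => t _; exact: integral_ge0.
  (* The two inner integrals are merged into one over the product law, whose measurability in the
     remaining variable is part of Tonelli. *)
  - pose nuv : probability V R := distribution P (v k).
    pose nuu : probability R R := distribution P (u k).
    have -> : (fun w => \int[nuu]_t \int[nuv]_s h (s, t, Z w))%E =
        (fun w => \int[nuv \x nuu]_z h (z, Z w))%E.
      apply/funext => w; rewrite (fubini_tonelli2 (m1 := nuv) (m2 := nuu)
        (fun z => h (z, Z w)))//.
      by apply: (measurableT_comp mh); exact: measurable_fun_pair.
    have mint := measurable_fun_fubini_tonelli_G (m1 := product_subprobability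
      (nuv : subprobability V R, nuu : subprobability R R)) h mh h0.
    exact: (measurableT_comp mint (measurable_funP Z)).
  - exact/measurable_EFinP.
rewrite -ge0_integralZl_EFin//; last 2 first.
- by move=> w _; rewrite lee_fin sqr_ge0.
- exact/measurable_EFinP.
apply: (le_trans (leeD2r _ le1)).
(* Adding the gradient term under the integral cancels the negative term of [bnd] before the
   integral is split. *)
rewrite -ge0_integralD//; last 4 first.
- by move=> w _; rewrite lee_fin.
- exact/measurable_EFinP.
- by move=> w _; rewrite lee_fin mulr_ge0 ?sqr_ge0.
- by apply/measurable_EFinP; exact: measurable_funM.
rewrite (_ : (fun w => _)%E =
  (fun w => p%:E * (f (x k w) - fs)%:E + r%:E)%E); last first.
  by apply/funext => w; rewrite -!EFinM -!EFinD /bnd; congr _%:E; ring.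
rewrite ge0_integralD//; last 2 first.
- by move=> w _; rewrite lee_fin mulr_ge0// subr_ge0.
- by apply/measurable_EFinP; exact: measurable_funM.
rewrite (has_mean_cst P r).2 ge0_integralZl_EFin//.
- by move=> w _; rewrite lee_fin subr_ge0.
- exact/measurable_EFinP.
Qed.

End sgd_step.

(** * Summability and the running minimum *)

Section recursion.
Context (R : realType).

(** A discrete Gronwall inequality. Of the extended real sequences only the initial value [phi 0] is
    assumed finite; finiteness of the rest follows from the recursion. *)
Lemma sum_le_of_recursion (phi gam : nat -> \bar R) (q e : nat -> R)
    (a b S p0 : R) :
  (forall k, 0 <= phi k)%E -> (forall k, 0 <= gam k)%E ->
  (forall k, 0 <= q k) -> (forall k, 0 <= e k) -> 0 <= a -> 0 <= b ->
  0 <= p0 -> phi 0%N = p0%:E -> (forall n, \sum_(0 <= k < n) e k <= S) ->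
  (forall k, phi k.+1 + (q k)%:E * gam k <=
    (1 + a * e k)%:E * phi k + (b * e k)%:E)%E ->
  forall n, (\sum_(0 <= k < n) (q k)%:E * gam k <=
    (expR (a * S) * (p0 + b * S))%:E)%E.
Proof.
move=> phi0 gam0 q0 e0 a0 b0 p00 phi0E eS rec n.
pose E n := \sum_(0 <= k < n) e k.
have E0 m : 0 <= E m by apply: sumr_ge0.
have W0 m : (0 <= \sum_(0 <= k < m) (q k)%:E * gam k)%E.
  by apply: sume_ge0 => k _; rewrite mule_ge0// lee_fin.
(* The products of the factors 1 + a e_k are absorbed by expR (a * E n). *)
suff H : (phi n + \sum_(0 <= k < n) (q k)%:E * gam k <=
    (expR (a * E n) * (p0 + b * E n))%:E)%E.
  apply: (@le_trans _ _ (expR (a * E n) * (p0 + b * E n))%:E).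
    by apply: le_trans H; rewrite leeDr.
  have En := eS n; rewrite lee_fin ler_pM ?expR_ge0 ?addr_ge0 ?mulr_ge0//.
    by rewrite ler_expR ler_wpM2l.
  by rewrite lerD2l ler_wpM2l.
elim: n => [|n IH].
  by rewrite /E !big_geq// adde0 phi0E !mulr0 expR0 mul1r addr0.
rewrite big_nat_recr//= [X in (_ + X)%E]addeC addeA.
apply: (le_trans (leeD2r _ (rec n))).
set W := (\sum_(0 <= k < n) _)%E in IH *.
have a1 : 0 <= 1 + a * e n by rewrite addr_ge0// mulr_ge0.
(* The factor is at least 1, so it may also multiply the accumulated sum [W], which lets the
   induction hypothesis apply. *)
apply: (@le_trans _ _ ((1 + a * e n)%:E * (phi n + W) + (b * e n)%:E)%E).
  rewrite ge0_muleDr//; last exact: W0.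
  rewrite addeAC; apply: leeD2r; apply: leeD2l.
  by rewrite -[leLHS]mul1e; apply: lee_wpmul2r; rewrite ?W0// lee_fin lerDl mulr_ge0.
apply: (@le_trans _ _ ((1 + a * e n)%:E *
    (expR (a * E n) * (p0 + b * E n))%:E + (b * e n)%:E)%E).
  by apply: leeD2r; apply: lee_wpmul2l; rewrite ?lee_fin.
rewrite -EFinM -EFinD lee_fin.
have -> : E n.+1 = E n + e n by rewrite /E big_nat_recr.
rewrite [a * (_ + _)]mulrDr expRD.
have := expR_ge1Dx (a * e n); set y := expR (a * e n) => y1.
have x1 : 1 <= expR (a * E n) by rewrite -expR0 ler_expR mulr_ge0.
set xx := expR _ in x1 *.
have be : 0 <= b * e n by rewrite mulr_ge0.
have bE : 0 <= p0 + b * E n by rewrite addr_ge0// mulr_ge0.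
have y2 : 1 <= y by apply: le_trans y1; rewrite lerDl mulr_ge0.
(* The first summand uses 1 + t <= exp t; the new term [b * e n] is only multiplied by two factors
   that are at least 1. *)
rewrite [b * (_ + _)]mulrDr addrA [leRHS]mulrDr; apply: lerD.
  by rewrite mulrA [xx * y]mulrC ler_wpM2r// ler_wpM2r// ltW// (lt_le_trans _ x1).
by rewrite -[leLHS]mul1r ler_wpM2r// -[1]mulr1 ler_pM.
Qed.

Lemma min_before_le (g : nat -> R) (k t : nat) : (t < k)%N ->
  min_before g k <= g t.
Proof.
by move=> tk; exact: (bigmin_le (g 0%N) (Ordinal tk) (fun i : 'I_k => g i)).
Qed.

Lemma min_before_ge0 (g : nat -> R) k : (forall t, 0 <= g t) ->
  0 <= min_before g k.
Proof. by move=> g0; apply: le_bigmin. Qed.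

Lemma min_before_sum_cvg0 (eta g : nat -> R) :
  (forall k, 0 <= eta k) -> (forall k, 0 <= g k) ->
  (\sum_(0 <= k <oo) (eta k)%:E = +oo)%E ->
  (\sum_(0 <= k <oo) (eta k * g k)%:E < +oo)%E ->
  (min_before g k * \sum_(0 <= t < k) eta t) @[k --> \oo] --> (0 : R).
Proof.
move=> eta0 g0 etaoo gfin.
pose S k := \sum_(0 <= t < k) eta t.
have mono k l : (k <= l)%N -> S k <= S l.
  move=> kl; rewrite /S [leRHS](big_cat_nat (leq0n k) kl) /= lerDl.
  by apply: sumr_ge0.
have Soo M : \forall k \near \oo, M <= S k.
  have [n Mn] : exists n, M <= S n.
    apply: contrapT => /forallNP H.
    have : (\sum_(0 <= k <oo) (eta k)%:E <= M%:E)%E.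
      apply: lime_le; first by apply: is_cvg_nneseries => k _ _; rewrite lee_fin.
      by apply: nearW => k; rewrite sumEFin lee_fin ltW// ltNge; apply/negP/H.
    by rewrite etaoo leye_eq.
  by exists n => // k /= nk; apply: le_trans Mn _; exact: mono.
apply/cvgrPdist_le => eps eps0.
have [N tailN] : exists N, forall k, (N <= k)%N ->
    \sum_(N <= t < k) eta t * g t <= eps / 2.
  have : (\sum_(N <= k <oo) (eta k * g k)%:E)%E @[N --> \oo] --> 0%E.
    by apply: nneseries_tail_cvg => // k; rewrite lee_fin mulr_ge0.
  move=> /fine_cvgP[fin /cvgrPdist_le/(_ (eps / 2))].
  rewrite divr_gt0// => /(_ isT) H.
  near \oo => N; exists N => k Nk.
  have finN : (\sum_(N <= k <oo) (eta k * g k)%:E)%E \is a fin_num.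
    by near: N; exact: fin.
  have : `|0 - fine (\sum_(N <= k <oo) (eta k * g k)%:E)%E| <= eps / 2.
    by near: N; exact: H.
  rewrite sub0r normrN => /(le_trans (ler_norm _)); apply: le_trans.
  rewrite -lee_fin fineK// -sumEFin; apply: nneseries_lim_ge => i _ _.
  by rewrite lee_fin mulr_ge0.
near=> k.
have Nk : (N <= k)%N by near: k; exact: nbhs_infty_ge.
(* Then [S k] is at most twice S k - S N, so the tail bound [eps / 2] yields [eps]. *)
have S2 : 2 * S N <= S k by near: k; exact: Soo.
have m0 : 0 <= min_before g k by exact: min_before_ge0.
rewrite sub0r normrN ger0_norm ?mulr_ge0//; last exact: sumr_ge0.
rewrite -/(S k).
have SE : S k = S N + \sum_(N <= t < k) eta t.
  by rewrite /S (big_cat_nat (leq0n N) Nk).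
have : min_before g k * \sum_(N <= t < k) eta t <= eps / 2.
  apply: le_trans (tailN _ Nk); rewrite mulr_sumr big_nat [leRHS]big_nat.
  apply: ler_sum => t /andP[_ tk]; rewrite mulrC ler_wpM2l//.
  exact: min_before_le.
have := ler_wpM2l m0 S2; rewrite SE; set q := \sum_(N <= t < k) _; nra.
Unshelve. all: by end_near. Qed.

End recursion.

(** * Moments of the factors and almost sure summability of the gradients *)

Section sgd.
Context (R : realType) (dO : measure_display) (Omega : measurableType dO)
  (P : probability Omega R).

(** Boundedness gives both moments, so that [mean] and [var] are genuine values and not defaults of
    [fine]. The bound [m2 <= c * mean P u] comes from u^2 <= c u. *)
Lemma bounded_factor_moments (u : {RV P >-> R}) (c : R) :
  (\forall w \ae P, 0 < u w <= c) ->
  exists m2, [/\ has_mean P u (mean P u), has_mean P (fun w => u w ^+ 2) m2,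
    var P u = m2 - mean P u ^+ 2, 0 <= var P u &
    [/\ 0 <= m2, m2 <= c * mean P u, 0 <= mean P u & mean P u <= c]].
Proof.
move=> uc.
have mu : measurable_fun [set: Omega] u by exact: measurable_funP.
have hm : has_mean P u (mean P u).
  rewrite /mean unlock; apply: (has_mean_ae_bounded (c := c)) => //.
  by apply: filterS uc => w /andP[u0 uc]; rewrite gtr0_norm.
have hm2 : has_mean P (fun w => u w ^+ 2)
    (fine (\int[P]_w (u w ^+ 2)%:E)).
  apply: (has_mean_ae_bounded (c := c ^+ 2)); first exact: measurable_funX.
  apply: filterS uc => w /andP[u0 uc].
  by rewrite ger0_norm ?sqr_ge0// lerXn2r// nnegrE ltW// (lt_le_trans u0).
set m := mean P u in hm *; set m2 := fine _ in hm2; exists m2.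
have hv : has_mean P (fun w => (u w - m) * (u w - m)) (m2 - m ^+ 2).
  have -> : (fun w => (u w - m) * (u w - m)) =
      (fun w => u w ^+ 2 + (- (2 * m) * u w + m ^+ 2)).
    by apply/funext => w; ring.
  rewrite (_ : m2 - _ = m2 + (- (2 * m) * m + m ^+ 2)); last by ring.
  apply: has_meanD => //; apply: has_meanD; last exact: has_mean_cst.
  exact: has_meanZ.
have varE : var P u = m2 - m ^+ 2.
  by rewrite /var /variance unlock -/(mean P u) -/m unlock; have [_ ->] := hv.
split => //.
  rewrite varE; apply: has_mean_ae_ge0 hv; apply: aeW => w.
  by rewrite -expr2 sqr_ge0.
split.
- by apply: has_mean_ae_ge0 hm2; apply: aeW => w; rewrite sqr_ge0.
- rewrite -subr_ge0.
  have : has_mean P (fun w => c * u w + -1 * u w ^+ 2) (c * m + -1 * m2).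
    by apply: has_meanD; apply: has_meanZ.
  rewrite mulN1r; apply: has_mean_ae_ge0.
  by apply: filterS uc => w /andP[u0 uc]; nra.
- by apply: has_mean_ae_ge0 hm; apply: filterS uc => w /andP[/ltW].
- rewrite -subr_ge0.
  have : has_mean P (fun w => c + -1 * u w) (c + -1 * m).
    by apply: has_meanD; [exact: has_mean_cst|exact: has_meanZ].
  rewrite mulN1r; apply: has_mean_ae_ge0.
  by apply: filterS uc => w /andP[u0 uc]; lra.
Qed.

(** The quotient is [r k] times a null sequence, hence squeezed between 0 and [c] times that
    sequence. Stating the rate through its inverse also covers [k = 0], where both sides are 0. *)
Lemma as_littleo_scaled (g : nat -> Omega -> R) (eta b r : nat -> R) (c : R) :
  (forall k w, 0 <= g k w) -> (forall k, 0 <= eta k) ->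
  (\forall w \ae P, (min_before (g ^~ w) k * \sum_(0 <= t < k) eta t)
    @[k --> \oo] --> (0 : R)) ->
  (forall k, (b k)^-1 = r k * \sum_(0 <= t < k) eta t) ->
  (forall k, 0 <= r k <= c) ->
  as_littleo P (fun k w => min_before (g ^~ w) k) b.
Proof.
move=> g0 eta0 cvg0 bE rc; apply: filterS cvg0 => w cvg0.
have cvgc : (c * (min_before (g ^~ w) k * \sum_(0 <= t < k) eta t))
    @[k --> \oo] --> (0 : R).
  by rewrite -[X in _ --> X](mulr0 c); exact: (cvgM (cvg_cst c) cvg0).
apply: squeeze_cvgr (cvg_cst 0) cvgc; apply: nearW => k.
have S0 : 0 <= \sum_(0 <= t < k) eta t by apply: sumr_ge0.
have m0 : 0 <= min_before (g ^~ w) k by exact: min_before_ge0.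
have /andP[r0 rck] := rc k.
rewrite bE mulrCA; apply/andP; split; first by rewrite !mulr_ge0.
by rewrite ler_wpM2r// mulr_ge0.
Qed.

Context (d : nat) (dV : measure_display) (V : measurableType dV)
  (D : probability V R) (fv : V -> 'rV[R]_d -> R) (f : 'rV[R]_d -> R)
  (L A B C fs : R).
Context (fv_diff : forall s y, differentiable (fv s) y)
  (fv_meas : forall y, measurable_fun [set: V] (fv ^~ y))
  (unbiased : forall y i,
    (\int[D]_s (grad (fv s) y 0 i)%:E)%E = (grad f y 0 i)%:E)
  (L_gt0 : 0 < L) (f_smooth : smooth L f) (f_ge : forall y, fs <= f y)
  (ABC : forall y, (\int[D]_s (enorm (grad (fv s) y) ^+ 2)%:E <=
    (A * (f y - fs) + B * enorm (grad f y) ^+ 2 + C)%:E)%E).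
Context (v : nat -> {RV P >-> V}) (u : nat -> {RV P >-> R})
  (eta : nat -> R) (x0 : 'rV[R]_d) (x : nat -> Omega -> 'rV[R]_d).
Context
  (v_law : forall k (S : set V), measurable S -> distribution P (v k) S = D S)
  (uv_indep : independent_draws P v u)
  (x_init : forall w, x 0%N w = x0)
  (x_step : forall k w,
      x k.+1 w = x k w - (eta k * u k w) *: grad (fv (v k w)) (x k w))
  (eta_ge0 : forall k, 0 <= eta k)
  (eta2_sum : (\sum_(0 <= k <oo) (eta k ^+ 2)%:E < +oo)%E).
Context (m m2 : nat -> R) (M c : R).
Context (u_mean : forall k, has_mean P (u k) (m k))
  (u_mean2 : forall k, has_mean P (fun w => u k w ^+ 2) (m2 k))
  (m2_ge0 : forall k, 0 <= m2 k) (m2_le : forall k, m2 k <= M) (c_gt0 : 0 < c)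
  (descent : forall k, c <= m k - L / 2 * eta k * m2 k * B).

Let G k w := enorm (grad f (x k w)) ^+ 2.

Let measurable_G k : measurable_fun [set: Omega] (G k).
Proof.
have -> : G k = (fun w => \sum_(i < d) grad f (x k w) 0 i ^+ 2).
  by apply/funext => w; rewrite /G enorm_sqr.
apply: measurable_sum => i; apply: measurable_funX.
apply: (@measurable_fun_grad _ _ _ _ (fun=> f) (x k)) => [y|_ y|j].
- by [].
- exact: f_smooth.1.
- exact: (iterate_measurable fv_diff fv_meas x_init x_step).
Qed.

Lemma sgd_expected_sum_lty :
  (\sum_(0 <= k <oo) (eta k)%:E * \int[P]_w (G k w)%:E < +oo)%E.
Proof.
have M0 : 0 <= M := le_trans (m2_ge0 0) (m2_le 0).
have L20 : 0 <= L / 2 by rewrite divr_ge0// ltW.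
(* The signs of [A] and [C] are not prescribed, hence the absolute values; [M] bounds all second
   moments of the factors. *)
pose a := L / 2 * M * `|A|; pose b := L / 2 * M * `|C|.
have a0 : 0 <= a by rewrite mulr_ge0 // mulr_ge0.
have b0 : 0 <= b by rewrite mulr_ge0 // mulr_ge0.
pose phi k := (\int[P]_w (f (x k w) - fs)%:E)%E.
pose gam k := (\int[P]_w (G k w)%:E)%E.
have gam0 k : (0 <= gam k)%E.
  by apply: integral_ge0 => w _; rewrite lee_fin sqr_ge0.
have phi0 k : (0 <= phi k)%E.
  by apply: integral_ge0 => w _; rewrite lee_fin subr_ge0.
have rec k : (phi k.+1 + (c * eta k)%:E * gam k <=
    (1 + a * eta k ^+ 2)%:E * phi k + (b * eta k ^+ 2)%:E)%E.
  apply: (expected_sgd_step fv_diff fv_meas unbiased L_gt0 f_smooth f_ge ABC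
    v_law uv_indep x_init x_step (u_mean k) (u_mean2 k)).
  - by rewrite addr_ge0// mulr_ge0// sqr_ge0.
  - by rewrite mulr_ge0// ltW.
  - by rewrite mulr_ge0// sqr_ge0.
  move=> y; set De := f y - fs; set Ga := _ ^+ 2.
  have De0 : 0 <= De by rewrite subr_ge0.
  have Ga0 : 0 <= Ga by rewrite sqr_ge0.
  pose s := L / 2 * eta k ^+ 2.
  have s0 : 0 <= s by rewrite mulr_ge0// sqr_ge0.
  have sm0 : 0 <= s * m2 k by exact: mulr_ge0.
  have hA : s * m2 k * (A * De) <= s * M * (`|A| * De).
    apply: (@le_trans _ _ (s * m2 k * (`|A| * De))).
      by apply: (ler_wpM2l sm0); apply: (ler_wpM2r De0); exact: ler_norm.
    by apply: ler_wpM2r; [exact: mulr_ge0|exact: ler_wpM2l].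
  have hC : s * m2 k * C <= s * M * `|C|.
    apply: (@le_trans _ _ (s * m2 k * `|C|)).
      by apply: (ler_wpM2l sm0); exact: ler_norm.
    by apply: ler_wpM2r; [exact: normr_ge0|exact: ler_wpM2l].
  (* After the [B] term has been absorbed into the linear decrease, [descent] still leaves the
     multiple [c * eta k] of the squared gradient norm. *)
  have hG : c * (eta k * Ga) <= (m k - L / 2 * eta k * m2 k * B) * (eta k * Ga).
    by apply: ler_wpM2r; [exact: mulr_ge0|exact: descent].
  rewrite -subr_ge0.
  rewrite (_ : _ - _ = (s * M * (`|A| * De) - s * m2 k * (A * De)) +
    (s * M * `|C| - s * m2 k * C) +
    ((m k - L / 2 * eta k * m2 k * B) * (eta k * Ga) - c * (eta k * Ga))).
    by apply: addr_ge0; [apply: addr_ge0|]; rewrite subr_ge0.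
  by rewrite /a /b /s; field.
have eS n : \sum_(0 <= k < n) eta k ^+ 2 <=
    fine (\sum_(0 <= k <oo) (eta k ^+ 2)%:E)%E.
  rewrite -lee_fin fineK.
    by rewrite -sumEFin; apply: nneseries_lim_ge => k _ _; rewrite lee_fin sqr_ge0.
  rewrite ge0_fin_numE//; apply: nneseries_ge0 => k _ _.
  by rewrite lee_fin sqr_ge0.
have fx0 : 0 <= f x0 - fs by rewrite subr_ge0.
have phi00 : phi 0%N = (f x0 - fs)%:E.
  rewrite /phi (_ : (fun w => _) = (fun=> (f x0 - fs)%:E)).
    exact: (has_mean_cst P _).2.
  by apply/funext => w; rewrite x_init.
have ce0 k : 0 <= c * eta k by rewrite mulr_ge0// ltW.
have part := sum_le_of_recursion phi0 gam0 ce0 (fun k => sqr_ge0 (eta k))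
  a0 b0 fx0 phi00 eS rec.
set Mx := (expR _ * _)%:E in part.
apply: (@le_lt_trans _ _ ((c^-1)%:E * Mx)%E); last by rewrite -EFinM ltry.
apply: lime_le.
  by apply: is_cvg_nneseries => k _ _; apply: mule_ge0; rewrite ?lee_fin//;
    exact: gam0.
apply: nearW => n.
rewrite (_ : (\sum_(0 <= k < n) _)%E =
  ((c^-1)%:E * \sum_(0 <= k < n) (c * eta k)%:E * gam k)%E).
  by apply: lee_wpmul2l; [rewrite lee_fin invr_ge0 ltW|exact: part].
rewrite ge0_sume_distrr; last by move=> k _; apply: mule_ge0; rewrite ?lee_fin.
by apply: eq_bigr => k _; rewrite muleA -EFinM mulrA mulVf ?mul1r// gt_eqF.
Qed.

(** Tonelli exchanges sum and expectation, and a nonnegative function with finite integral is finite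
    almost everywhere. *)
Lemma sgd_sum_lty :
  \forall w \ae P, (\sum_(0 <= k <oo) (eta k * G k w)%:E < +oo)%E.
Proof.
pose F w := (\sum_(0 <= k <oo) (eta k * G k w)%:E)%E.
have t0 k w : (0 <= (eta k * G k w)%:E)%E by rewrite lee_fin mulr_ge0// sqr_ge0.
have mt k : measurable_fun [set: Omega] (fun w => (eta k * G k w)%:E).
  by apply/measurable_EFinP; exact: measurable_funM.
have F0 w : (0 <= F w)%E by apply: nneseries_ge0.
have iF : P.-integrable [set: Omega] F.
  apply/integrableP; split; first exact: ge0_emeasurable_sum.
  under eq_integral do rewrite gee0_abs//.
  rewrite integral_nneseries//.
  apply: le_lt_trans sgd_expected_sum_lty.
  rewrite le_eqVlt; apply/orP; left; apply/eqP; apply: eq_eseriesr => k _.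
  rewrite -ge0_integralZl_EFin//.
  - by move=> w _; rewrite lee_fin sqr_ge0.
  - exact/measurable_EFinP.
apply: filterS (integrable_ae measurableT iF) => w /(_ I).
by rewrite ge0_fin_numE.
Qed.

End sgd.

(** * The three rates: a descent constant and a bounded prefactor for each *)

Unset Implicit Arguments.
Set Strict Implicit.

Theorem theorem1 (R : realType) (d : nat)
    (dV : measure_display) (V : measurableType dV) (D : probability V R)
    (fv : V -> 'rV[R]_d -> R) (f : 'rV[R]_d -> R) (L A B C : R)
    (xstar : 'rV[R]_d)
    (dO : measure_display) (Omega : measurableType dO) (P : probability Omega R)
    (v : nat -> {RV P >-> V}) (u : nat -> {RV P >-> R})
    (eta : nat -> R) (x0 : 'rV[R]_d) (x : nat -> Omega -> 'rV[R]_d)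
    (c2 mu1 : R)
    (fv_differentiable : forall s y, differentiable (fv s) y)
    (fv_integrable : forall y, D.-integrable setT (fun s => (fv s y)%:E))
    (f_mean : forall y, (f y)%:E = ('E_D[fun s => fv s y])%E)
    (unbiased : forall y i, ('E_D[fun s => grad (fv s) y ord0 i])%E = (grad f y ord0 i)%:E)
    (L_gt0 : 0 < L)
    (f_smooth : smooth L f)
    (xstar_min : forall y, f xstar <= f y)
    (B_gt0 : 0 < B)
    (ABC : forall y, ('E_D[fun s => (enorm (grad (fv s) y) ^+ 2)%R] <=
      (A * (f y - f xstar) + B * enorm (grad f y) ^+ 2 + C)%:E)%E)
    (v_law : forall k (S : set V), measurable S -> distribution P (v k) S = D S)
    (uv_indep : independent_draws P v u)
    (x_init : forall w, x 0%N w = x0)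
    (x_step : forall k w,
      x k.+1 w = x k w - (eta k * u k w) *: grad (fv (v k w)) (x k w))
    (u_bounds : forall k, \forall w \ae P, 0 < u k w <= c2)
    (c2_sup : c2%:E = ereal_sup (range (fun k => ess_sup P (EFin \o u k))))
    (mu1_gt0 : 0 < mu1)
    (mu1_le : forall k, mu1 <= mean P (u k))
    (mu1_inf : mu1 = inf (range (fun k => mean P (u k))))
    (mean_monotone : nondecreasing_seq (fun k => mean P (u k)) \/
                     nonincreasing_seq (fun k => mean P (u k)))
    (eta_decr : nonincreasing_seq eta)
    (eta_sum : (\sum_(0 <= k <oo) (eta k)%:E = +oo)%E)
    (eta2_sum : (\sum_(0 <= k <oo) (eta k ^+ 2)%:E < +oo)%E)
    (eta_ratio_sum :
      (\sum_(1 <= k <oo) (eta k / \sum_(0 <= j < k) eta j)%:E = +oo)%E) :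
  [/\ nonincreasing_seq (fun k => mean P (u k)) ->
      nondecreasing_seq (fun k => var P (u k)) ->
      (forall k, mean P (u k) > var P (u k) + 1) ->
      (forall k, 0 <= eta k <= 1 / (B * L * mean P (u k))) ->
      as_littleo P
        (fun k w => min_before (fun t => enorm (grad f (x t w)) ^+ 2) k)
        (fun k => (mean P (u k) - var P (u k))^-1 / \sum_(0 <= t < k) eta t),
      nonincreasing_seq (fun k => mean P (u k)) ->
      (forall k, 0 <= eta k <= 1 / (B * L * c2)) ->
      as_littleo P
        (fun k w => min_before (fun t => enorm (grad f (x t w)) ^+ 2) k)
        (fun k => 1 / (mean P (u k) * \sum_(0 <= t < k) eta t))
    & nondecreasing_seq (fun k => mean P (u k)) ->
      nonincreasing_seq (fun k => var P (u k)) ->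
      (forall k, mean P (u k) < 1) ->
      (forall k, var P (u k) / mean P (u k) < 1) ->
      (forall k, 0 <= eta k <= 1 / (B * L)) ->
      as_littleo P
        (fun k w => min_before (fun t => enorm (grad f (x t w)) ^+ 2) k)
        (fun k => (mean P (u k) - var P (u k)) / \sum_(0 <= t < k) eta t)].
Proof.
pose m k := mean P (u k); pose fs := f xstar.
have fv_meas y : measurable_fun [set: V] (fv ^~ y).
  by apply/measurable_EFinP; exact: measurable_int (fv_integrable y).
have unb y i : (\int[D]_s (grad (fv s) y 0 i)%:E)%E = (grad f y 0 i)%:E.
  by rewrite -unbiased unlock.
have ABC' y : (\int[D]_s (enorm (grad (fv s) y) ^+ 2)%:E <=
    (A * (f y - fs) + B * enorm (grad f y) ^+ 2 + C)%:E)%E.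
  by have := ABC y; rewrite unlock.
have /choice[m2 Hm2] := fun k => bounded_factor_moments (u_bounds k).
have Em k : has_mean P (u k) (m k) by case: (Hm2 k).
have Em2 k : has_mean P (fun w => u k w ^+ 2) (m2 k) by case: (Hm2 k).
have varE k : var P (u k) = m2 k - m k ^+ 2 by case: (Hm2 k).
have var0 k : 0 <= var P (u k) by case: (Hm2 k).
have m20 k : 0 <= m2 k by case: (Hm2 k) => _ _ _ _ [].
have m2m k : m2 k <= c2 * m k by case: (Hm2 k) => _ _ _ _ [].
have mc2 k : m k <= c2 by case: (Hm2 k) => _ _ _ _ [].
have m0 k : 0 < m k by exact: lt_le_trans (mu1_le k).
have c20 : 0 < c2 by exact: lt_le_trans (mc2 0%N).
have m2M k : m2 k <= c2 * c2.
  by apply: le_trans (m2m k) _; rewrite ler_wpM2l// ltW.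
pose g k w := enorm (grad f (x k w)) ^+ 2.
have g0 k w : 0 <= g k w by exact: sqr_ge0.
(* All three cases share this step; each has only to supply a positive [c], uniform in [k], from its
   step size bound. *)
have key c : 0 < c -> (forall k, 0 <= eta k) ->
    (forall k, c <= m k - L / 2 * eta k * m2 k * B) ->
    \forall w \ae P, (min_before (g ^~ w) k * \sum_(0 <= t < k) eta t)
      @[k --> \oo] --> (0 : R).
  move=> c0 eta0 desc.
  have := sgd_sum_lty fv_differentiable fv_meas unb L_gt0 f_smooth xstar_min
    ABC' v_law uv_indep x_init x_step eta0 eta2_sum Em Em2 m20 m2M c0 desc.
  by apply: filterS => w; apply: min_before_sum_cvg0 => // k; exact: g0.
have descE k : L / 2 * eta k * m2 k * B = (eta k * (B * L)) * m2 k / 2 by ring.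
have BL0 : 0 < B * L by exact: mulr_gt0.
split.
- move=> m_decr _ m_gt eta_le.
  have eta0 k : 0 <= eta k by case/andP: (eta_le k).
  have m1 k : 1 < m k by have := m_gt k; have := var0 k; rewrite -/(m k); lra.
  apply: (as_littleo_scaled (eta := eta) (c := m 0%N) g0
    (r := fun k => m k - var P (u k))) => //.
  (* eta_k B L E[u_k^2] <= (Var u_k + E[u_k]^2) / E[u_k] <= Var u_k + E[u_k] *)
  + apply: (key (1 / 2)) => [|//|k]; first by rewrite divr_gt0.
    rewrite descE; set X := eta k * (B * L).
    have X0 : 0 <= X by rewrite mulr_ge0// ltW.
    have Xm : X * m k <= 1.
      have /andP[_] := eta_le k.
      by rewrite ler_pdivlMr; [rewrite mulrA|exact: mulr_gt0 BL0 (m0 k)].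
    have := m_gt k; rewrite -/(m k).
    have := varE k; have := var0 k; have := m1 k.
    set V' := var _ _ => m1k V0 VE Vm.
    have -> : m2 k = V' + m k * m k by rewrite VE; ring.
    have h1 : X * m k * m k <= m k by rewrite -[leRHS]mul1r ler_wpM2r// ltW.
    have h2 : X * m k * V' <= V' by rewrite -[leRHS]mul1r ler_wpM2r.
    (* Since [1 < m k], the bound on [X * m k] controls [X * V'] too. Thus X * m2 k <= V' + m k, and
       what remains is at least (m k - V') / 2 > 1 / 2. *)
    have h3 : X * V' <= X * m k * V'.
      by rewrite ler_wpM2r// -[leLHS]mulr1 ler_wpM2l// ltW.
    lra.
  + by move=> k; rewrite invfM !invrK.
  (* The prefactor is at most [m k], the variance being nonnegative, and so at most [m 0]. *)
  + move=> k; rewrite subr_ge0; have := m_gt k; rewrite -/(m k).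
    have := var0 k; have : m k <= m 0%N by exact: m_decr.
    by move=> h1 h2 h3; apply/andP; split; lra.
- move=> m_decr eta_le.
  have eta0 k : 0 <= eta k by case/andP: (eta_le k).
  apply: (as_littleo_scaled (eta := eta) (c := m 0%N) g0 (r := m)) => //.
  (* eta_k B L E[u_k^2] <= E[u_k^2] / c2 <= E[u_k] *)
  + apply: (key (mu1 / 2)) => [|//|k]; first by rewrite divr_gt0.
    rewrite descE; set X := eta k * (B * L).
    have X0 : 0 <= X by rewrite mulr_ge0// ltW.
    have Xc : X * c2 <= 1.
      have /andP[_] := eta_le k.
      by rewrite ler_pdivlMr; [rewrite mulrA|exact: mulr_gt0].
    have h1 : X * m2 k <= X * (c2 * m k) by rewrite ler_wpM2l.
    have h2 : X * c2 * m k <= m k by rewrite -[leRHS]mul1r ler_wpM2r// ltW.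
    (* With X * m2 k <= m k at least half of the mean remains, and this is at least [mu1 / 2]. *)
    have := mu1_le k; rewrite -/(m k) => h3; lra.
  + by move=> k; rewrite div1r invrK.
  + by move=> k; rewrite ltW//=; exact: m_decr.
- move=> m_incr var_decr m_lt1 var_lt eta_le.
  have eta0 k : 0 <= eta k by case/andP: (eta_le k).
  (* By the two monotonicities the gap between mean and variance is smallest at [k = 0]. It bounds
     the descent from below and, inverted, the prefactor from above. *)
  pose del := m 0%N - var P (u 0%N).
  have del0 : 0 < del.
    by have := var_lt 0%N; rewrite ltr_pdivrMr; [rewrite mul1r subr_gt0|exact: m0].
  have del_le k : del <= m k - var P (u k).
    have h1 : m 0%N <= m k by exact: m_incr.
    have h2 : var P (u k) <= var P (u 0%N) by exact: var_decr.
    by rewrite lerB.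
  apply: (as_littleo_scaled (eta := eta) (c := del^-1) g0
    (r := fun k => (m k - var P (u k))^-1)) => //.
  (* E[u_k] - E[u_k^2] / 2 = (E[u_k] - Var u_k) / 2 + E[u_k] (1 - E[u_k]) / 2 *)
  + apply: (key (del / 2)) => [|//|k]; first by rewrite divr_gt0.
    rewrite descE; set X := eta k * (B * L).
    have X1 : X <= 1.
      have /andP[_] := eta_le k.
      by rewrite ler_pdivlMr.
    have h1 : X * m2 k <= m2 k by rewrite -[leRHS]mul1r ler_wpM2r.
    have h2 : m2 k = var P (u k) + m k * m k by rewrite varE; ring.
    have h3 : m k * m k <= m k.
      by rewrite -[leRHS]mul1r ler_wpM2r// ltW//; exact: m_lt1.
    have := del_le k; lra.
  + by move=> k; rewrite invfM invrK.
  + move=> k; have d0 := lt_le_trans del0 (del_le k).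
    by rewrite invr_ge0 ltW//= lef_pV2// posrE.
Qed.
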